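(* Let $k,\ell\in\mathbb{N}$ (positive integers). If the complete graph $K_n$ has a $k$-local edge-coloring in which every monochromatic graph is $C_{2\ell+1}$-free, then $$n\le 2\ell(2\ell-1)^{k-1}\prod_{d=2}^{k}\bigl(1+\rho_d+\rho_d^{-1}\bigr).$$
   Context: All graphs are finite and simple. $C_m$ denotes the cycle on $m$ vertices; a graph is $C_m$-free if it contains no cycle on $m$ vertices as a (not necessarily induced) subgraph. For fixed $\ell\ge 1$ and every integer $d\ge2$, $$\rho_d=\min\{\rho\in[1,\infty): 1+\rho+\rho^2+\cdots+\rho^\ell\ge d\}.$$ An edge-coloring (an arbitrary assignment of colors to edges) is called $k$-local if at most $k$ distinct colors appear on the edges incident with each vertex; the total number of colors used in the graph may be larger than $k$. For a color $c$, the monochromatic graph of color $c$ (the color-$c$ graph) is the spanning subgraph whose edge set consists exactly of the edges of color $c$. The empty product (case $k=1$) equals $1$. *)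

(* Defs.v *)
From HB Require Import structures.
From mathcomp Require Import all_boot all_order all_algebra.
From mathcomp Require Import all_classical all_reals.

Set Implicit Arguments.
Unset Strict Implicit.
Unset Printing Implicit Defensive.

Import Order.TTheory GRing.Theory Num.Theory.
Local Open Scope ring_scope.

(* A simple graph on a finite vertex type T is an irreflexive symmetric rel T. *)
Definition complete_graph (n : nat) : rel 'I_n := fun x y => x != y.
Arguments complete_graph : clear implicits.

(* For 3 <= m, the m-cycles of e are the duplicate-free closed e-walks listing
   m vertices. (For m < 3 this is not the graph-theoretic notion.) *)
Definition cycle_free (T : finType) (e : rel T) (m : nat) : Prop :=
  forall s : seq T, size s = m -> ~ ucycle e s.

(* An edge-coloring of e is a function c on vertex sets, of which only the
   values at the edges [set x; y], e x y, are ever used. *)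
Definition color_graph (T : finType) (C : eqType) (e : rel T)
    (c : {set T} -> C) (a : C) : rel T :=
  fun x y => e x y && (c [set x; y]%SET == a).

Definition colors_at (T : finType) (C : eqType) (e : rel T)
    (c : {set T} -> C) (v : T) : seq C :=
  undup [seq c [set v; w]%SET | w in e v].

Definition local_coloring (T : finType) (C : eqType) (e : rel T)
    (c : {set T} -> C) (k : nat) : Prop :=
  forall v : T, (size (colors_at e c v) <= k)%N.

Definition rho_set (R : realType) (l d : nat) : set R :=
  [set r : R | 1 <= r /\ d%:R <= \sum_(0 <= i < l.+1) r ^+ i]%classic.
Arguments rho_set : clear implicits.

(* For 0 < l this infimum is a minimum, see rho_min. *)
Definition rho (R : realType) (l d : nat) : R := inf (rho_set R l d).

Lemma rho_min (R : realType) (l d : nat) : (0 < l)%N ->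
  rho_set R l d (rho R l d) /\
  (forall r : R, rho_set R l d r -> rho R l d <= r).
Proof.
move=> l0.
suff [r Sr lbr] : exists2 r : R, rho_set R l d r &
    (forall y, rho_set R l d y -> r <= y).
  have -> : rho R l d = r by
    apply/eqP; rewrite eq_le; apply/andP; split;
      [apply: ge_inf => //; exists r | apply: lb_le_inf => //; exists r].
  by split.
have [dl|ld] := leqP d l.+1.
  exists 1; last by move=> y [].
  split=> //; under eq_bigr do rewrite expr1n.
  by rewrite big_const_nat subn0 iter_addr_0 ler_nat.
pose p : {poly R} := \poly_(i < l.+1) 1 - d%:R%:P.
have pE x : p.[x] = \sum_(0 <= i < l.+1) x ^+ i - d%:R.
  rewrite /p hornerD hornerN hornerC horner_poly big_mkord.
  by under eq_bigr do rewrite mul1r.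
have d1 : 1 <= d%:R :> R by rewrite ler1n; case: d ld {p pE}.
have p1 : p.[1] <= 0.
  rewrite pE; under eq_bigr do rewrite expr1n.
  by rewrite big_const_nat subn0 iter_addr_0 subr_le0 ler_nat ltnW.
have pd : 0 <= p.[d%:R].
  rewrite pE subr_ge0 big_nat_recl // big_ltn // expr1.
  rewrite addrCA lerDl addr_ge0 ?expr0 // sumr_ge0 // => i _.
  by rewrite exprn_ge0 // ler0n.
have [|r /andP[r1 _] /rootP] := poly_ivt d1 (p := p); first by rewrite p1 pd.
rewrite pE => /eqP; rewrite subr_eq0 => /eqP pr.
exists r; first by split=> //; rewrite pr.
move=> y [y1 dy]; rewrite leNgt; apply/negP => yr.
move: dy; rewrite -pr leNgt => /negP; apply.
have y0 : 0 <= y := le_trans ler01 y1.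
rewrite !(big_ltn (ltn0Sn l)) !expr0 ltrD2l.
rewrite !(big_ltn (_ : 1 < l.+1)%N) // !expr1.
apply: ltr_leD; first exact: yr.
apply: ler_sum => i _.
by apply: lerXn2r; rewrite ?nnegrE ?y0 ?(ltW yr) ?(le_trans ler01 r1).
Qed.

(* Main.v *)
Require Import Defs.
From HB Require Import structures.
From mathcomp Require Import all_boot all_order all_algebra.
From mathcomp Require Import all_classical all_reals.
From mathcomp Require Import zify ring lra.
From mathcomp Require Import fintype finset.
Import Order.TTheory GRing.Theory Num.Theory.

Set Implicit Arguments.
Unset Strict Implicit.
Unset Printing Implicit Defensive.

(** Write g(0) = 1, g(1) = 2l and
    g(d) = g(d-1) (2l-1) (1 + rho_d + 1/rho_d), so that g(k) is the claimed
    bound.  For a set S of vertices let d(u) be the number of colours at u on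
    edges inside S, and give u the weight 1/g(d(u)).  The weights of S add up
    to at most 1 ([total_weight_le1]).  For the set of all vertices each
    weight is at least 1/g(k), and the theorem follows.

    The bound on the total weight is proved by passing to smaller sets without
    losing weight.  Let v be a vertex of S with the fewest colours, d of them.
    If d >= 2, some colour a carries at least a 1/d share of the weight of
    S minus v.  In the colour-a graph on S let N_0 = {v}, N_1, N_2, ... be the
    layers by distance from v.  Since 1 + rho_d + ... + rho_d^l >= d, the
    layers cannot keep growing by a factor rho_d, so there is i <= l with
    w(N_(i-1)) + w(N_(i+1)) <= (rho_d + 1/rho_d) w(N_i) ([balanced_level]).
    As the graph has no cycle of length 2l+1, N_i contains an a-independent
    set I with w(N_i) <= (2l-1) w(I) ([layer_independent]).  Delete from S the
    three layers except for I.  The vertices of I now see no edge of colour a,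
    so their weights have grown by a factor of at least
    (2l-1) (1 + rho_d + 1/rho_d), because they had at least d colours.  This
    makes up for what was deleted ([weight_thin_out]).  The case d = 1 is
    similar, with all of S in place of the three layers, and for d = 0 the set
    S is the single vertex v.

    For [layer_independent], order N_i by a depth-first traversal of a
    breadth-first tree.  A path in N_i with 2l vertices that increases in this
    order yields a cycle of length 2l+1: a suitable segment of it is closed up
    through the lowest common ancestor of its vertices
    ([monotone_path_cycle]).  So increasing paths have at most 2l-1 vertices,
    and N_i splits into 2l-1 independent sets
    ([independent_of_bounded_paths]). *)

(** * Breadth-first layers *)

Lemma cycle_mkseq (T : Type) (e : rel T) (Z : nat -> T) n :
  (forall m, m < n -> e (Z m) (Z m.+1)) -> Z n = Z 0 -> cycle e (mkseq Z n).
Proof.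
case: n => // n Ze Zn; have -> : mkseq Z n.+1 = Z 0 :: mkseq (Z \o S) n.
  by rewrite /mkseq -[n.+1]add1n iotaD /= (iotaDl 1 0) -map_comp.
have E : rcons (mkseq (Z \o S) n) (Z 0) = mkseq (Z \o S) n.+1.
  by rewrite mkseqS /= Zn.
rewrite /= E.
apply/(pathP (Z 0)) => i; rewrite size_mkseq => iN.
rewrite nth_mkseq //=.
case: i iN => [|i] iN /=; first exact: Ze.
by rewrite nth_mkseq //=; [exact: Ze | exact: ltnW].
Qed.

Section Layers.
Variables (T : finType) (e : rel T) (v : T).

Fixpoint ball j : {set T} :=
  if j is j'.+1 then ball j' :|: [set u | [exists w in ball j', e w u]]
  else [set v].

Definition layer j : {set T} :=
  if j is j'.+1 then ball j :\: ball j' else [set v].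

Lemma ball_mono i j : i <= j -> ball i \subset ball j.
Proof.
elim: j => [|j IH]; first by rewrite leqn0 => /eqP->.
rewrite leq_eqVlt => /predU1P[->//|/IH /subset_trans]; apply; exact: subsetUl.
Qed.

Lemma ball_nbr j u w : u \in ball j -> e u w -> w \in ball j.+1.
Proof.
by move=> uj uw; rewrite !inE; apply/orP; right; apply/existsP; exists u; apply/andP.
Qed.

Lemma layer_sub_ball j : layer j \subset ball j.
Proof. by case: j => [|j] //; exact: subsetDl. Qed.

Lemma layer_notin_ball i j u : i < j -> u \in layer j -> u \notin ball i.
Proof.
case: j => // j; rewrite ltnS => /ball_mono /subsetP ij /setDP[_].
by apply: contra => /ij.
Qed.

Lemma layer_inj i j u : u \in layer i -> u \in layer j -> i = j.
Proof.
move=> ui uj; case: (ltngtP i j) => // [ij|ji].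
  by have := layer_notin_ball ij uj; rewrite (subsetP (layer_sub_ball i)).
by have := layer_notin_ball ji ui; rewrite (subsetP (layer_sub_ball j)).
Qed.

Lemma ball_layer j u : u \in ball j -> exists2 i, i <= j & u \in layer i.
Proof.
elim: j => [|j IH] uj; first by exists 0.
have [uj'|uj'] := boolP (u \in ball j); last by exists j.+1 => //; apply/setDP.
by have [i ij ui] := IH uj'; exists i => //; exact: leqW.
Qed.

Hypothesis e_sym : symmetric e.

Lemma layer1E u : irreflexive e -> (u \in layer 1) = e v u.
Proof.
move=> e_irr; apply/setDP/idP => [[]|vu].
  rewrite !inE => /orP[->//|/exists_inP[y]].
  by rewrite inE => /eqP->.
split; first by apply: (@ball_nbr 0); rewrite ?inE.
by rewrite inE; apply: contraTneq vu => ->; rewrite e_irr.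
Qed.

Lemma layer_nbr i u w : u \in layer i -> e u w ->
  exists2 j, [|| j == i, j == i.+1 | i == j.+1] & w \in layer j.
Proof.
move=> ui uw.
have [j ji wj] := ball_layer (ball_nbr (subsetP (layer_sub_ball i) u ui) uw).
exists j => //; suff: i <= j.+1 by lia.
rewrite leqNgt; apply/negP => ij.
have := layer_notin_ball ij ui.
rewrite (@ball_nbr _ w) // ?(subsetP (layer_sub_ball j)) //.
by rewrite e_sym.
Qed.

Lemma layer_parent_ex j u : u \in layer j.+1 -> exists2 w, e u w & w \in layer j.
Proof.
move=> uj; have /setDP[] := uj; rewrite inE => /orP[-> //|].
rewrite inE => /exists_inP[w wj wu] uNj; rewrite e_sym in wu; exists w => //.
have [i ij wi] := ball_layer wj.
have [k ik uk] := layer_nbr wi (etrans (e_sym _ _) wu).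
have jk := layer_inj uj uk.
by have -> : j = i by lia.
Qed.

Lemma layer_parent : exists p : T -> T,
  forall j u, u \in layer j.+1 -> e u (p u) /\ p u \in layer j.
Proof.
pose P u w := forall j, u \in layer j.+1 -> e u w /\ w \in layer j.
suff /boolp.choice[p pP] : forall u, exists w, P u w by exists p => j u; exact: pP.
move=> u; have [[j uj]|uN] := pselect (exists j, u \in layer j.+1); last first.
  by exists u => j uj; case: uN; exists j.
have [w uw wj] := layer_parent_ex uj.
by exists w => i /layer_inj /(_ uj) [->].
Qed.

(** * Long increasing paths in a layer close up to odd cycles *)

Section Tree.
Variable p : T -> T.
Hypothesis pP : forall j u, u \in layer j.+1 -> e u (p u) /\ p u \in layer j.

(** A number encoding the ancestors of u, read from the root down, as digits
    in base #|T|.  Comparing keys within a layer compares ancestor sequences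
    lexicographically, which is the order of a depth-first traversal of the
    tree [p]: the descendants of each vertex form an interval. *)
Fixpoint key j u : nat :=
  if j is j'.+1 then key j' (p u) * #|T| + enum_rank u else 0.

Lemma key_inj i : {in layer i &, injective (key i)}.
Proof.
case: i => [|i] x y; first by rewrite !inE => /eqP-> /eqP->.
move=> _ _ /= /(congr1 (modn^~ #|T|)); rewrite !modnMDl !modn_small //.
by move/val_inj/enum_rank_inj.
Qed.

Lemma key_parent j x y : key j.+1 x <= key j.+1 y -> key j (p x) <= key j (p y).
Proof.
have T0 : 0 < #|T| by apply/card_gt0P; exists x.
move=> /(leq_div2r #|T|) /=; rewrite !divnMDl // !divn_small //.
by rewrite !addn0.
Qed.

Lemma key_ancestor s j x y :
  key (s + j) x <= key (s + j) y -> key j (iter s p x) <= key j (iter s p y).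
Proof.
elim: s x y => [|s IH] x y //.
by rewrite addSn !iterSr => /key_parent /IH.
Qed.

Lemma layer_ancestor s j x : x \in layer (s + j) -> iter s p x \in layer j.
Proof.
elim: s x => [|s IH] x //.
by rewrite addSn iterSr => /pP[_ /IH].
Qed.

(** A path with t edges inside layer i, whose end points have their lowest
    common ancestor exactly s levels higher, closes up through the tree to a
    cycle of length t + 2s.  The list follows the path, then climbs from its
    last vertex to the common ancestor, then descends towards its first
    vertex. *)
Lemma cycle_through_ancestor i s t (X : nat -> T) :
  0 < s -> s <= i ->
  (forall m, m <= t -> X m \in layer i) ->
  (forall m, m < t -> e (X m) (X m.+1)) ->
  (forall m n, m < n <= t -> X m != X n) ->
  iter s p (X 0) = iter s p (X t) ->
  iter s.-1 p (X 0) != iter s.-1 p (X t) ->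
  ucycle e (mkseq (fun m => if m <= t then X m
     else if m <= t + s then iter (m - t) p (X t)
     else iter (t + s + s - m) p (X 0)) (t + s + s)).
Proof.
move=> s0 si Xi Xe Xn eq_s ne_s; set Z := fun m => _.
have anc r m : m <= t -> r <= i -> iter r p (X m) \in layer (i - r).
  by move=> /Xi mi ri; apply: layer_ancestor; rewrite subnKC.
have anc_e r m : m <= t -> r < i -> e (iter r p (X m)) (iter r.+1 p (X m)).
  move=> mt ri; have := anc r m mt (ltnW ri).
  by rewrite (_ : i - r = (i - r.+1).+1) => [/pP[]|]; last by lia.
have anc_inj r r' m m' : m <= t -> m' <= t -> r <= i -> r' <= i ->
    iter r p (X m) = iter r' p (X m') -> r = r'.
  move=> mt mt' ri ri' E; have := anc r m mt ri; rewrite E => /layer_inj.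
  by move/(_ _ (anc r' m' mt' ri')); lia.
have ne_r r : r < s -> iter r p (X 0) != iter r p (X t).
  move=> rs; apply: contraNneq ne_s => E.
  have -> : s.-1 = (s.-1 - r) + r by lia.
  by rewrite !iterD E.
apply/andP; split.
  have ZZ : Z (t + s + s) = Z 0.
    by rewrite /Z leq0n ifN ?ifN ?subnn //; lia.
  apply: cycle_mkseq ZZ => m mL; rewrite /Z.
  case: (ltngtP m t) => [mt|tm|->].
  - exact: Xe.
  - case: ifP => mts.
      have [mts'|mts'] := ltnP m (t + s).
        rewrite subSn; last exact: ltnW.
        by apply: anc_e; lia.
      have -> : m = t + s by lia.
      rewrite addKn -eq_s e_sym.
      have -> : t + s + s - (t + s).+1 = s.-1 by lia.
      by have := anc_e s.-1 0 (leq0n t); rewrite prednK //; apply; lia.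
    rewrite ifN; last by lia.
    have -> : t + s + s - m = (t + s + s - m.+1).+1 by lia.
    by rewrite e_sym; apply: anc_e; lia.
  - rewrite -addn1 leq_add2l s0 addKn.
    by apply: (anc_e 0 t); lia.
apply/mkseq_uniqP => m m' mL mL'.
wlog mm : m m' mL mL' / m < m' => [W E|].
  by case: (ltngtP m m') => // lt; [exact: W | apply/esym/W].
have {}mL' : m' < t + s + s := mL'.
rewrite /Z; case: ifP => mt.
  case: ifP => mt'.
    by move=> E; have := Xn m m'; rewrite E eqxx mm mt' => /(_ isT).
  case: ifP => mts E.
    have H : 0 = m' - t by apply: (anc_inj 0 _ _ _ mt (leqnn t) _ _ E); lia.
    by lia.
  have H : 0 = t + s + s - m' by apply: (anc_inj 0 _ _ _ mt (leq0n t) _ _ E); lia.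
  by lia.
rewrite (_ : m' <= t = false); last by lia.
case: ifP => mts; case: ifP => mts' E.
- have H : m - t = m' - t.
    by apply: (anc_inj _ _ _ _ (leqnn t) (leqnn t) _ _ E); lia.
  by lia.
- have H : m - t = t + s + s - m'.
    by apply: (anc_inj _ _ _ _ (leqnn t) (leq0n t) _ _ E); lia.
  by move: E; rewrite H => /esym/eqP; rewrite (negbTE (ne_r _ _)) //; lia.
- by lia.
- have H : t + s + s - m = t + s + s - m'.
    by apply: (anc_inj _ _ _ _ (leq0n t) (leq0n t) _ _ E); lia.
  by lia.
Qed.

(** Let s be the height of the lowest common ancestor of the 2l vertices.  It
    suffices to find two of them at distance t = 2(l-s)+1 along the path that
    lie below different children of that ancestor: then t + 2s = 2l + 1.
    Since keys increase, the vertices below one child are consecutive on the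
    path.  So if vertices at distance t were always below the same child,
    then, as t >= 1, so would be neighbours on the path, hence all vertices,
    against the choice of s. *)
Lemma monotone_path_cycle l i (X : nat -> T) : 0 < i <= l ->
  (forall m, m < 2 * l -> X m \in layer i) ->
  (forall m, m.+1 < 2 * l ->
     e (X m) (X m.+1) && (key i (X m) < key i (X m.+1))) ->
  ~ cycle_free e (2 * l + 1).
Proof.
move=> /andP[i0 il] Xi Xe.
have key_lt m n : m < n < 2 * l -> key i (X m) < key i (X n).
  elim: n => // n IH /andP[]; rewrite ltnS leq_eqVlt => mn nl.
  have /andP[_ kn] := Xe n nl.
  by case/predU1P: mn => [->//|mn]; apply: ltn_trans kn; apply: IH; lia.
have sandwich r a b c : r <= i -> a <= b <= c -> c < 2 * l ->
    iter r p (X a) = iter r p (X c) -> iter r p (X b) = iter r p (X a).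
  move=> ri /andP[ab bc] cl E; have ir : i = r + (i - r) by lia.
  have mono x y : x <= y -> y < 2 * l ->
      key (i - r) (iter r p (X x)) <= key (i - r) (iter r p (X y)).
    move=> xy yl; apply: key_ancestor; rewrite -ir.
    move: xy; rewrite leq_eqVlt => /predU1P[->//|xy].
    by apply/ltnW/key_lt; rewrite xy.
  have anc x : x < 2 * l -> iter r p (X x) \in layer (i - r).
    by move=> /Xi xi; apply: layer_ancestor; rewrite -ir.
  apply: (@key_inj (i - r)); rewrite ?anc //; try lia.
  by apply/eqP; rewrite eqn_leq {1}E !mono //; lia.
have root x : x < 2 * l -> iter i p (X x) = v.
  by move=> /Xi; rewrite -{1}[i]addn0 => /layer_ancestor /set1P.
(* As keys increase, the lowest common ancestor of the two end points is that
   of all vertices of the path. *)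
have [|s /eqP s_top s_min] := @ex_minnP
    (fun s => iter s p (X 0) == iter s p (X (2 * l).-1)).
  by exists i; rewrite !root //; lia.
have s0 : 0 < s.
  rewrite lt0n; apply/negP => /eqP s0; move: s_top; rewrite s0 /= => E.
  by have := key_lt 0 (2 * l).-1; rewrite E ltnn; lia.
have si : s <= i by apply: s_min; rewrite !root //; lia.
pose f x := iter s.-1 p (X x); pose t := 2 * (l - s) + 1.
have [/existsP[[a al] /= ne_a]|/existsPn all_eq] := boolP
    [exists a : 'I_(2 * l - t), f a != f (a + t)]; last first.
  have step b : b.+1 < 2 * l -> f b = f b.+1.
    (* the window [a, a + t] contains b and b.+1 and fits in the path *)
    move=> bl; pose a := minn b (2 * l - t).-1.
    have a_lt : a < 2 * l - t by rewrite /a /t; lia.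
    have /negPn/eqP /= E := all_eq (Ordinal a_lt).
    have E1 : f b = f a.
      by apply: (sandwich _ a b (a + t)) E; rewrite /a /t; lia.
    have E2 : f b.+1 = f a.
      by apply: (sandwich _ a b.+1 (a + t)) E; rewrite /a /t; lia.
    by rewrite E1 E2.
  have const b : b < 2 * l -> f b = f 0.
    by elim: b => // b IH bl; rewrite -step // IH // ltnW.
  have := s_min s.-1; rewrite -/(f 0) -/(f _) const ?eqxx; last by lia.
  by move/(_ isT); lia.
have at_lt : a + t < 2 * l by lia.
have top x : x < 2 * l -> iter s p (X x) = iter s p (X 0).
  by move=> xl; apply: (sandwich _ 0 x (2 * l).-1) s_top; lia.
have uc := @cycle_through_ancestor i s t (fun m => X (a + m)) s0 si.
move=> cf; apply: cf (uc _ _ _ _ _) => //.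
- by rewrite size_mkseq /t; lia.
- by move=> m mt; apply: Xi; lia.
- by move=> m mt; rewrite addnS; have /andP[] := Xe (a + m) ltac:(lia).
- move=> m n /andP[mn nt]; apply/negP => /eqP E.
  by have := key_lt (a + m) (a + n); rewrite E ltnn; lia.
- by rewrite addn0 !top //; lia.
- by rewrite addn0.
Qed.

End Tree.
End Layers.

(** * Heavy independent sets in layers *)

Section Peeling.
Local Open Scope ring_scope.
Variables (T : finType) (e : rel T) (key : T -> nat).
Variables (R : realDomainType) (w : T -> R).
Hypothesis e_sym : symmetric e.

Definition independent (I : {set T}) := {in I &, forall x y, ~~ e x y}.

(** Orient every edge towards its larger key.  The sources of A are
    independent, and removing them shortens all directed paths, since each
    path that avoids them starts at a vertex with a predecessor in A.  So A
    splits into q independent sets, one of which has at least the average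
    weight. *)
Lemma independent_of_bounded_paths q (A : {set T}) :
  {in A &, injective key} -> irreflexive e ->
  (forall s, size s = q.+1 -> {subset s <= A} ->
     ~~ sorted (fun x y => e x y && (key x < key y)%N) s) ->
  exists I : {set T}, [/\ I \subset A, independent I &
    \sum_(u in A) w u <= q%:R * \sum_(u in I) w u].
Proof.
move=> + e_irr; pose e' x y := e x y && (key x < key y)%N.
rewrite -/e'.
elim: q A => [|q IH] A key_inj nopath.
  have A0 : A = set0.
    apply/setP => x; rewrite inE; apply/negP => xA.
    suff: ~~ true by [].
    by apply: (nopath [:: x]) => // y; rewrite inE => /eqP->.
  exists set0; split; first exact: sub0set.
    by move=> x y; rewrite inE.
  by rewrite A0 big_set0 mul0r.
pose M := [set x in A | [forall y in A, ~~ e' y x]].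
have MA : M \subset A by apply/subsetP => x; rewrite inE => /andP[].
have M_indep : independent M.
  move=> x y; rewrite !inE => /andP[xA /forall_inP xM] /andP[yA /forall_inP yM].
  apply/negP => xy; have := xM y yA; have := yM x xA.
  rewrite /e' [e y x]e_sym xy /= -!leqNgt => yx xy'.
  have E : x = y by apply: key_inj => //; apply/eqP; rewrite eqn_leq yx xy'.
  by move: xy; rewrite E e_irr.
have [|s|I [IA I_indep wI]] := IH (A :\: M).
- by move=> x y /setDP[xA _] /setDP[yA _]; exact: key_inj.
- case: s => // x s [ss] sA; apply/negP => sorted_s.
  have /setDP[xA] : x \in A :\: M by apply: sA; rewrite inE eqxx.
  rewrite inE xA /= => /forall_inPn[y yA /negPn yx].
  have : ~~ sorted e' (y :: x :: s).
    apply: nopath => [|z]; first by rewrite /= ss.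
    by rewrite inE => /predU1P[->//|/sA]; exact: (subsetP (subsetDl _ _)).
  by rewrite /= yx; move: sorted_s => /= ->.
have split_w : \sum_(u in A) w u = \sum_(u in M) w u + \sum_(u in A :\: M) w u.
  by rewrite (big_setID M) /= (setIidPr MA).
have I_sub_A := subset_trans IA (subsetDl A M).
have [le_MI|/ltW le_IM] := leP (\sum_(u in M) w u) (\sum_(u in I) w u).
  exists I; split=> //.
  by rewrite split_w -natr1 mulrDl mul1r addrC lerD.
exists M; split=> //.
rewrite split_w -natr1 mulrDl mul1r addrC lerD //.
by apply: le_trans wI _; rewrite ler_wpM2l.
Qed.
End Peeling.

Local Open Scope ring_scope.

(** A weighted form of the (2l-1)-colourability of the first l layers of a
    C_(2l+1)-free graph: bounded increasing paths, fed to the peeling lemma. *)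
Lemma layer_independent (T : finType) (e : rel T) (R : realDomainType)
    (w : T -> R) (v : T) l i :
  symmetric e -> irreflexive e -> (0 < i <= l)%N ->
  cycle_free e (2 * l + 1) ->
  exists I : {set T}, [/\ I \subset layer e v i, independent e I &
    \sum_(u in layer e v i) w u <= (2 * l - 1)%:R * \sum_(u in I) w u].
Proof.
move=> e_sym e_irr il cf; have [p pP] := layer_parent v e_sym.
apply: (@independent_of_bounded_paths _ _ (key p i)) => //; first exact: (key_inj (e := e)).
move=> s ss si; have {}ss : size s = (2 * l)%N by lia.
apply/negP => /(sortedP v) sorted_s.
apply: (monotone_path_cycle e_sym pP (X := nth v s) il) cf => m ml.
  by apply/si/mem_nth; rewrite ss.
by apply: sorted_s; rewrite ss.
Qed.

(** * Weighted counting *)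

Lemma ler_sum_setU (R : numDomainType) (T : finType) (w : T -> R) (A B : {set T}) :
  (forall x, 0 <= w x) ->
  \sum_(x in A :|: B) w x <= \sum_(x in A) w x + \sum_(x in B) w x.
Proof.
move=> w0; rewrite [leLHS](big_setID A) /= setUK setDUl setDv.
rewrite set0U lerD2l [leRHS](big_setID A) /= lerDr.
by apply: sumr_ge0.
Qed.

Lemma sum_layers (R : numDomainType) (T : finType) (w : T -> R) (e : rel T) v n :
  \sum_(0 <= j < n.+1) \sum_(x in layer e v j) w x = \sum_(x in ball e v n) w x.
Proof.
elim: n => [|n IH]; first by rewrite big_nat1.
rewrite big_nat_recr //= IH [RHS](big_setID (ball e v n)) /=.
by rewrite (setIidPr _) // (@ball_mono _ e v n n.+1).
Qed.

Lemma heavy_color_class (R : realDomainType) (T : finType) (C : eqType) (w : T -> R)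
    (A : {set T}) (f : T -> C) (cs : seq C) :
  uniq cs -> (0 < size cs)%N -> (forall x, x \in A -> f x \in cs) ->
  exists2 a, a \in cs &
    \sum_(x in A) w x <= (size cs)%:R * \sum_(x in A | f x == a) w x.
Proof.
move=> cs_uniq cs0 fA.
have sumE : \sum_(a <- cs) \sum_(x in A | f x == a) w x = \sum_(x in A) w x.
  rewrite (exchange_big_dep (mem A)) /=; last by move=> a x _ /andP[].
  apply: eq_bigr => x xA; rewrite -big_filter.
  rewrite (eq_filter (a2 := pred1 (f x))); last first.
    by move=> a /=; rewrite xA eq_sym.
  by rewrite filter_pred1_uniq ?fA // big_seq1.
have [/hasP[a acs le_a]|/hasPn lt] := boolP (has (fun a =>
    \sum_(x in A) w x <= (size cs)%:R * \sum_(x in A | f x == a) w x) cs).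
  by exists a.
suff: \sum_(a <- cs) (size cs)%:R * \sum_(x in A | f x == a) w x <
      \sum_(a <- cs) \sum_(x in A) w x.
  by rewrite -mulr_sumr sumE big_const_seq count_predT iter_addr_0 mulr_natl ltxx.
rewrite big_seq [ltRHS]big_seq; apply: ltr_sum.
  by case: cs cs0 {lt fA sumE cs_uniq} => // a cs _; rewrite /= inE eqxx.
by move=> a /lt; rewrite -ltNge.
Qed.

(** If no level were balanced, the inequality failing at level i would
    propagate growth by a factor larger than r from N i / N (i-1) to
    N (i+1) / N i.  Level 0 starts this off, so N (i+1) >= r ^ i N 1 up to
    i = l, strictly for i = 1.  The levels after the first would then have
    total more than N 1 (1 + r + ... + r ^ l) >= d N 1, exceeding W - N 0. *)
Lemma balanced_level (R : realFieldType) (N : nat -> R) (r W : R) (l d : nat) :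
  (0 < l)%N -> 0 < N 0%N -> 1 <= r ->
  d%:R <= \sum_(0 <= i < l.+1) r ^+ i ->
  W - N 0%N <= d%:R * N 1%N ->
  \sum_(0 <= i < l.+2) N i <= W ->
  exists i, [/\ (i <= l)%N, 0 < N i &
    (if i is i'.+1 then N i' else 0) + N i.+1 <= (r + r^-1) * N i].
Proof.
move=> l0 N0 r1 dr Wd sumW; have r0 : 0 < r by lra.
have [/existsP[i /andP[]]|/existsPn no] := boolP [exists i : 'I_l.+1,
    (0 < N i) &&
    ((if i : nat is i'.+1 then N i' else 0) + N i.+1 <= (r + r^-1) * N i)].
  by move=> Ni le_i; exists i; split=> //; rewrite -ltnS.
have fail i : (i <= l)%N -> 0 < N i ->
    (r + r^-1) * N i < (if i is i'.+1 then N i' else 0) + N i.+1.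
  move=> il Ni; have := no (Ordinal (il : (i < l.+1)%N)).
  by rewrite /= Ni /= -ltNge.
have grow i : (i <= l)%N -> 0 < N i /\ r * N i < N i.+1.
  elim: i => [|i IH] il.
    split=> //; have := fail 0%N isT N0; rewrite add0r mulrDl.
    by apply: le_lt_trans; rewrite lerDl mulr_ge0 ?invr_ge0 // ltW.
  have [Ni gi] := IH (ltnW il).
  have Ni1 : 0 < N i.+1 by apply: lt_trans gi; rewrite mulr_gt0.
  split=> //; have := fail i.+1 il Ni1; rewrite mulrDl.
  have : N i < r^-1 * N i.+1 by rewrite mulrC ltr_pdivlMr // mulrC.
  lra.
have grow_pow i : (i <= l)%N -> r ^+ i * N 1%N <= N i.+1.
  elim: i => [|i IH] il; first by rewrite expr0 mul1r.
  have [_ gi] := grow _ il; apply: le_trans (ltW gi).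
  by rewrite exprS -mulrA ler_pM2l // IH // ltnW.
have N1 : 0 < N 1%N by have [] := grow 1%N l0.
have : (\sum_(0 <= i < l.+1) r ^+ i) * N 1%N < \sum_(0 <= i < l.+1) N i.+1.
  rewrite mulr_suml !(big_ltn (ltn0Sn l)) !(big_ltn (_ : 1 < l.+1)%N) //.
  rewrite expr0 mul1r expr1 ler_ltD // ltr_leD //; first by have [] := grow 1%N l0.
  rewrite big_nat_cond [leRHS]big_nat_cond; apply: ler_sum => i.
  by rewrite andbT => /andP[_]; rewrite ltnS => /grow_pow.
move: sumW; rewrite big_nat_recl //.
have := ler_wpM2r (ltW N1) dr; lra.
Qed.

(** * The numerical bound *)

Section Factors.
Variables (R : realType) (l : nat).
Hypothesis l0 : (0 < l)%N.
Local Notation rho := (rho R l).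

Lemma rho_ge1 d : 1 <= rho d.
Proof. by have [[]] := rho_min R d l0. Qed.

Lemma rho_sum d : d%:R <= \sum_(0 <= i < l.+1) rho d ^+ i.
Proof. by have [[]] := rho_min R d l0. Qed.

Lemma le_rho d d' : (d <= d')%N -> rho d <= rho d'.
Proof.
move=> dd'; have [_] := rho_min R d l0; apply; split; first exact: rho_ge1.
by apply: le_trans (rho_sum d'); rewrite ler_nat.
Qed.

(** The factor by which the bound grows from d - 1 to d colours; one colour
    needs a separate value because that step is made by another argument. *)
Definition step_factor d : R :=
  if d == 1%N then (2 * l)%:R
  else (2 * l - 1)%:R * (1 + (rho d + (rho d)^-1)).

Definition size_bound d : R := \prod_(1 <= j < d.+1) step_factor j.

Lemma rho_inv_ge2 d : 2 <= rho d + (rho d)^-1.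
Proof.
have r1 := rho_ge1 d; have r0 : 0 < rho d by lra.
have : 0 <= (rho d - 1) ^+ 2 / rho d by rewrite divr_ge0 ?sqr_ge0 // ltW.
have -> : (rho d - 1) ^+ 2 / rho d = rho d + (rho d)^-1 - 2 by field; lra.
by rewrite subr_ge0.
Qed.

Lemma le_rho_inv d d' : (d <= d')%N ->
  rho d + (rho d)^-1 <= rho d' + (rho d')^-1.
Proof.
move=> /le_rho; set x := rho d; set y := rho d' => xy.
have x1 : 1 <= x := rho_ge1 d; have y1 : 1 <= y := rho_ge1 d'.
have : 0 <= (y - x) * (x * y - 1) / (x * y).
  rewrite divr_ge0 ?mulr_ge0 //; try nra.
have -> : (y - x) * (x * y - 1) / (x * y) = y + y^-1 - (x + x^-1) by field; lra.
by rewrite subr_ge0.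
Qed.

Lemma step_factor_ge d : (2 * l)%:R <= step_factor d.
Proof.
rewrite /step_factor; case: eqP => // _; have := rho_inv_ge2 d.
set x := rho d + _ => x2.
have : (2 * l)%:R = (2 * l - 1)%:R + 1 :> R by rewrite natr1; congr (_%:R); lia.
have : 1 <= (2 * l - 1)%:R :> R by rewrite ler1n; lia.
by move=> ? ->; nra.
Qed.

Lemma step_factor_ge1 d : 1 <= step_factor d.
Proof. by apply: le_trans (step_factor_ge d); rewrite ler1n; lia. Qed.

Lemma le_step_factor d d' : (1 < d <= d')%N ->
  (2 * l - 1)%:R * (1 + (rho d + (rho d)^-1)) <= step_factor d'.
Proof.
move=> /andP[d1 dd']; rewrite /step_factor ifN; last by lia.
by rewrite ler_wpM2l // lerD2l le_rho_inv.
Qed.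

Lemma size_boundS d : size_bound d.+1 = size_bound d * step_factor d.+1.
Proof. by rewrite /size_bound big_nat_recr. Qed.

Lemma size_bound_gt0 d : 0 < size_bound d.
Proof.
by apply: prodr_gt0 => i _; apply: lt_le_trans (step_factor_ge1 i); exact: ltr01.
Qed.

Lemma le_size_bound d d' : (d <= d')%N -> size_bound d <= size_bound d'.
Proof.
elim: d' => [|d' IH]; first by rewrite leqn0 => /eqP->.
rewrite leq_eqVlt => /predU1P[->//|/IH /le_trans]; apply.
by rewrite size_boundS ler_peMr ?step_factor_ge1 // ltW ?size_bound_gt0.
Qed.

Lemma size_boundE k : (0 < k)%N ->
  size_bound k = 2 * l%:R * (2 * l%:R - 1) ^+ (k - 1) *
             \prod_(2 <= d < k.+1) (1 + rho d + (rho d)^-1).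
Proof.
move=> k0; rewrite /size_bound big_ltn // {1}/step_factor eqxx natrM -[RHS]mulrA; congr (_ * _).
rewrite (_ : (k - 1 = k.+1 - 2)%N); last by lia.
rewrite -prodr_const_nat -big_split /=.
rewrite big_nat_cond [RHS]big_nat_cond; apply: eq_bigr => i.
rewrite andbT => /andP[i2 _]; rewrite /step_factor ifN; last by lia.
by rewrite natrB ?natrM ?addrA //; lia.
Qed.
End Factors.

(** * The weight of a local colouring *)

Section LocalColorings.
Variables (R : realType) (l : nat) (T : finType) (C : eqType) (c : {set T} -> C).
Hypothesis l0 : (0 < l)%N.

Definition complete_on (S : {set T}) : rel T :=
  fun x y => [&& x \in S, y \in S & x != y].

Hypothesis c_free : forall S a, cycle_free (color_graph (complete_on S) c a) (2 * l + 1).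

Local Notation mono S a := (color_graph (complete_on S) c a).
Local Notation colors S u := (colors_at (complete_on S) c u).

Definition ncolors S u := size (colors S u).

Lemma color_graph_sym S a : symmetric (mono S a).
Proof.
by move=> x y; rewrite /color_graph /complete_on setUC eq_sym andbCA.
Qed.

Lemma color_graph_irr S a : irreflexive (mono S a).
Proof. by move=> x; rewrite /color_graph /complete_on eqxx !andbF. Qed.

Lemma colorsP S u a : reflect (exists w, mono S a u w) (a \in colors S u).
Proof.
rewrite mem_undup; apply: (iffP mapP) => [[w]|[w /andP[uw /eqP <-]]].
  by rewrite mem_enum => uw ->; exists w; apply/andP.
by exists w; rewrite ?mem_enum.
Qed.

Lemma ncolors_sub (S S' : {set T}) u : S' \subset S -> (ncolors S' u <= ncolors S u)%N.
Proof.
move=> /subsetP S'S; apply: uniq_leq_size; first exact: undup_uniq.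
move=> a /colorsP[w /andP[/and3P[uS wS uw] auw]]; apply/colorsP; exists w.
by rewrite /color_graph /complete_on !S'S // uw.
Qed.

Lemma ncolors_drop (S S' : {set T}) u a : S' \subset S -> a \in colors S u ->
  (forall w, w \in S' -> ~~ mono S a u w) -> (ncolors S' u < ncolors S u)%N.
Proof.
move=> S'S aS no; have /subsetP S'S' := S'S.
apply: (@uniq_leq_size _ (a :: colors S' u)).
  rewrite /= undup_uniq andbT; apply/negP => /colorsP[w].
  move=> /andP[/and3P[uS wS uw] auw]; have /negP[] := no w wS.
  by rewrite /color_graph /complete_on !S'S' // uw.
move=> b; rewrite inE => /predU1P[->//|/colorsP[w /andP[/and3P[uS wS uw] auw]]].
by apply/colorsP; exists w; rewrite /color_graph /complete_on !S'S' // uw.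
Qed.

(** The recursion runs through subsets S, and the colours counted at u are
    those on edges inside S, so the weight of u increases when S shrinks. *)
Definition weight (S : {set T}) u : R := (size_bound R l (ncolors S u))^-1.

Lemma weight_gt0 (S : {set T}) u : 0 < weight S u.
Proof. by rewrite invr_gt0 size_bound_gt0. Qed.

Lemma le_weight (S S' : {set T}) u : S' \subset S -> weight S u <= weight S' u.
Proof.
move=> S'S; rewrite lef_pV2 ?posrE ?size_bound_gt0 // le_size_bound //.
exact: ncolors_sub.
Qed.

Lemma weight_gain (S S' : {set T}) u a (K : R) : S' \subset S -> a \in colors S u ->
  (forall w, w \in S' -> ~~ mono S a u w) -> K <= step_factor R l (ncolors S u) ->
  K * weight S u <= weight S' u.
Proof.
move=> S'S aS no; have := ncolors_drop S'S aS no.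
rewrite /weight; case: (ncolors S u) => // d; rewrite ltnS => dd Kf.
have f0 : 0 < step_factor R l d.+1 := lt_le_trans ltr01 (step_factor_ge1 R l0 d.+1).
rewrite size_boundS invfM mulrCA.
apply: (@le_trans _ _ (size_bound R l d)^-1); last first.
  by rewrite lef_pV2 ?posrE ?size_bound_gt0 // le_size_bound.
rewrite ler_piMr ?invr_ge0 ?(ltW (size_bound_gt0 _ _ _)) //.
by rewrite ler_pdivrMr // mul1r.
Qed.

Definition thin_out (S D I : {set T}) := (S :\: D) :|: I.

(** Each vertex of I loses colour a in the new set and thus gains a factor K,
    which pays for the vertices of D that are removed. *)
Lemma weight_thin_out (S D I : {set T}) a (K : R) :
  I \subset D -> D \subset S ->
  (forall u, u \in I -> a \in colors S u) ->
  (forall u w, u \in I -> w \in thin_out S D I -> ~~ mono S a u w) ->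
  (forall u, u \in I -> K <= step_factor R l (ncolors S u)) ->
  \sum_(u in D) weight S u <= K * \sum_(u in I) weight S u ->
  \sum_(u in S) weight S u <=
  \sum_(u in thin_out S D I) weight (thin_out S D I) u.
Proof.
move=> ID DS aI no KI DI.
have S'S : thin_out S D I \subset S.
  by rewrite subUset subsetDl (subset_trans ID).
rewrite (big_setID D) /= (setIidPr DS).
have -> : \sum_(u in thin_out S D I) weight (thin_out S D I) u =
    \sum_(u in I) weight (thin_out S D I) u +
    \sum_(u in S :\: D) weight (thin_out S D I) u.
  rewrite (big_setID I) /= (setIidPr (subsetUr _ _)).
  congr (_ + _); apply: eq_bigl => x; rewrite !inE.
  case: (boolP (x \in I)) => [xI|]; last by rewrite orbF.
  by rewrite (subsetP ID).
rewrite lerD //.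
  apply: le_trans DI _; rewrite mulr_sumr; apply: ler_sum => u uI.
  by apply: (weight_gain S'S (aI u uI)) => [w|]; [exact: no | exact: KI].
by apply: ler_sum => u _; exact: le_weight.
Qed.

(** By induction on #|S|, thinning out around a vertex v with the fewest
    colours.  That choice of v makes the factor gained by every vertex of S
    at least the one that the ratio rho of v calls for. *)
Lemma total_weight_le1 (S : {set T}) : \sum_(u in S) weight S u <= 1.
Proof.
have [n] := ubnP #|S|; elim: n S => // n IH S; rewrite ltnS => Sn.
have [->|[v0 v0S]] := set_0Vmem S; first by rewrite big_set0.
have [v vS v_min] := arg_minnP (ncolors S) v0S.
have {}vS : v \in S := vS.
have wt0 u : 0 <= weight S u by apply: ltW; exact: weight_gt0.
have reduce (D I : {set T}) a (K : R) z :
    I \subset D -> D \subset S -> z \in D -> z \notin I ->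
    (forall u, u \in I -> a \in colors S u) ->
    (forall u w, u \in I -> w \in thin_out S D I -> ~~ mono S a u w) ->
    (forall u, u \in I -> K <= step_factor R l (ncolors S u)) ->
    \sum_(u in D) weight S u <= K * \sum_(u in I) weight S u ->
    \sum_(u in S) weight S u <= 1.
  move=> ID DS zD zI aI no KI DI.
  apply: le_trans (weight_thin_out ID DS aI no KI DI) (IH _ _).
  apply: leq_trans Sn; apply: proper_card; apply/properP; split.
    by rewrite subUset subsetDl (subset_trans ID).
  by exists z; rewrite ?(subsetP DS) // !inE zD (negbTE zI).
have [d0|d0] := posnP (ncolors S v).
  have -> : S = [set v].
    apply/eqP; rewrite eqEsubset sub1set vS andbT.
    apply/subsetP => x xS; rewrite inE; apply: contraT => xv.
    have : c [set v; x]%SET \in colors S v.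
      by apply/colorsP; exists x; rewrite /color_graph /complete_on vS xS eq_sym xv /=.
    by move: d0; rewrite /ncolors => /size0nil ->.
  rewrite big_set1 invf_le1 ?size_bound_gt0 //.
  by apply: le_trans (le_size_bound R l0 (leq0n _)); rewrite /size_bound big_geq.
have [|a av heavy] := @heavy_color_class R T C (weight S) (S :\ v)
    (fun x => c [set v; x]%SET) (colors S v) (undup_uniq _) d0.
  move=> x /setD1P[xv xS]; apply/colorsP; exists x.
  by rewrite /color_graph /complete_on vS xS eq_sym xv /=.
set e := mono S a; pose N := layer e v.
have e_sym : symmetric e := color_graph_sym S a.
have e_irr : irreflexive e := color_graph_irr S a.
have eS x y : e x y -> (x \in S) && (y \in S).
  by move=> /andP[/and3P[-> ->]].
have NS j : N j \subset S.
  apply/subsetP => x; case: j => [|j]; first by rewrite inE => /eqP->.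
  by move=> /(layer_parent_ex e_sym)[y /eS/andP[]].
have N_color j u : u \in N j -> a \in colors S u.
  case: j => [|j]; first by rewrite inE => /eqP->.
  by move=> /(layer_parent_ex e_sym)[y uy _]; apply/colorsP; exists y.
have [z zN1] : exists z, z \in N 1.
  by have /colorsP[z vz] := av; exists z; rewrite layer1E.
have {}heavy : \sum_(u in S :\ v) weight S u <=
    (ncolors S v)%:R * \sum_(u in N 1) weight S u.
  rewrite [X in _ <= _ * X](eq_bigl (fun x => (x \in S :\ v) && (c [set v; x]%SET == a))) //.
  move=> x; rewrite layer1E // /e /color_graph /complete_on vS !inE /= eq_sym.
  by rewrite [(x \in S) && _]andbC.
have splitS : \sum_(u in S) weight S u =
    weight S v + \sum_(u in S :\ v) weight S u by rewrite (big_setD1 v).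
(* With one colour at v, the first layer is all of S but v, and the whole of
   S can be traded for the heavier of v and an independent set of layer 1. *)
have [d1|d1] := leqP (ncolors S v) 1.
  have {}d1 : ncolors S v = 1%N by lia.
  rewrite d1 mul1r in heavy.
  have Ke u : (2 * l)%:R <= step_factor R l (ncolors S u) by exact: step_factor_ge.
  have [I [IN I_ind wI]] :=
    layer_independent (weight S) v e_sym e_irr (i := 1) l0 (@c_free S a).
  have l2 : (2 * l)%:R = 1 + (2 * l - 1)%:R :> R.
    by rewrite nat1r; congr (_%:R); lia.
  have wN1 : \sum_(u in N 1) weight S u <= (2 * l - 1)%:R * \sum_(u in I) weight S u.
    exact: wI.
  have thin_outS J : thin_out S S J = J by rewrite /thin_out setDv set0U.
  have [le_vI|/ltW le_Iv] := leP (weight S v) (\sum_(u in I) weight S u).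
    apply: (reduce S I a (2 * l)%:R v) => //.
    - exact: subset_trans IN (NS 1%N).
    - apply: contraL (set11 v) => /(subsetP IN).
      by move=> vN; apply/negP => /(layer_inj (e := e) vN (j := 0%N)).
    - by move=> u /(subsetP IN); exact: N_color.
    - by move=> u w uI; rewrite thin_outS; exact: I_ind.
    - by rewrite splitS l2 mulrDl mul1r lerD // (le_trans heavy).
  apply: (reduce S [set v] a (2 * l)%:R z) => //.
  - by rewrite sub1set.
  - exact: subsetP (NS 1%N) z zN1.
  - by apply/negP => /(layer_inj (e := e) zN1 (j := 0%N)).
  - by move=> u; rewrite inE => /eqP->.
  - by move=> u w; rewrite thin_outS !inE => /eqP-> /eqP->; rewrite color_graph_irr.
  - rewrite big_set1 splitS l2 mulrDl mul1r lerD // (le_trans heavy) //.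
    by rewrite (le_trans wN1) // ler_wpM2l.
(* With more colours, a balanced layer N i is traded, together with its two
   neighbours, for an independent set in N i. *)
pose r := rho R l (ncolors S v).
pose w j := \sum_(u in N j) weight S u.
have w0 : w 0%N = weight S v by rewrite /w big_set1.
have [|||i [il wi balanced]] := @balanced_level R w r
    (\sum_(u in S) weight S u) l (ncolors S v) l0 _ (rho_ge1 R l0 _)
    (rho_sum R l0 _).
- by rewrite w0 weight_gt0.
- by rewrite splitS w0 addrAC subrr add0r.
- rewrite sum_layers [leRHS](big_setID (ball e v l.+1)) /= (setIidPr _).
    by rewrite lerDl sumr_ge0.
  apply/subsetP => x xb; have [j _] := @ball_layer _ e v l.+1 x xb.
  exact: (subsetP (NS j)).
pose prev := if i is i'.+1 then N i' else set0.
pose D := prev :|: N i :|: N i.+1.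
have [I [IN I_ind wI]] : exists I : {set T}, [/\ I \subset N i, independent e I &
    w i <= (2 * l - 1)%:R * \sum_(u in I) weight S u].
  case: (posnP i) => [->|i0].
    exists (N 0%N); split=> //; last first.
      by rewrite ler_peMl ?sumr_ge0 // ler1n; lia.
    by move=> x y; rewrite !inE => /eqP-> /eqP->; rewrite e_irr.
  have il0 : (0 < i <= l)%N by rewrite i0.
  exact: (layer_independent (weight S) v e_sym e_irr il0 (@c_free S a)).
have ID : I \subset D.
  by apply: subset_trans IN _; rewrite /D -setUA setUCA subsetUl.
have [y yD yI] : exists2 y, y \in D & y \notin I.
  case: (posnP i) => [i0|i_gt0].
    exists z; first by rewrite /D i0 !in_setU zN1 orbT.
    apply/negP => /(subsetP IN) zi.
    by have := layer_inj zN1 zi; rewrite i0.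
  have [u uN] : exists u, u \in N i.
    apply/set0Pn; apply: contraTneq wi => N0.
    by rewrite /w N0 big_set0 ltxx.
  have iE : i.-1.+1 = i by exact: prednK.
  have [|y _ yN] := @layer_parent_ex _ e v e_sym i.-1 u; first by rewrite iE.
  have prevE : prev = N i.-1 by rewrite /prev; case: (i) i_gt0.
  exists y; first by rewrite /D prevE !in_setU yN.
  apply/negP => /(subsetP IN) yi.
  by have := ltn_predL i; rewrite (layer_inj yN yi) ltnn i_gt0.
apply: (reduce D I a ((2 * l - 1)%:R * (1 + (r + r^-1))) y) => //.
- rewrite !subUset !NS !andbT /prev; case: (i) => [|i'] //.
  exact: sub0set.
- by move=> u /(subsetP IN); exact: N_color.
- (* edges of colour a at N i lead to the layers in D only *)
  move=> u x uI; rewrite inE => /orP[|xI]; last exact: I_ind.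
  rewrite inE => /andP[xD xS]; apply: contra xD => ux.
  have [j /or3P ij xN] := layer_nbr e_sym (subsetP IN u uI) ux.
  rewrite /D /prev !in_setU.
  by case: ij => /eqP ji; rewrite ji in xN *; rewrite xN ?orbT.
- move=> u /(subsetP IN) /(subsetP (NS i)) uS.
  by apply: le_step_factor => //; rewrite d1 v_min.
- have le_D : \sum_(u in D) weight S u <= (1 + (r + r^-1)) * w i.
    apply: le_trans (ler_sum_setU _ _ wt0) _.
    rewrite mulrDl mul1r [leRHS]addrC.
    apply: le_trans (_ : \sum_(u in prev) weight S u + w i + w i.+1 <= _).
      by rewrite lerD2r ler_sum_setU.
    rewrite addrAC lerD2r; apply: le_trans balanced; rewrite lerD2r.
    by rewrite /prev; case: (i) => [|i']; rewrite ?big_set0.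
  apply: le_trans le_D _; rewrite mulrC [_ * (1 + _)]mulrC -mulrA mulrC.
  rewrite ler_wpM2l //.
  by have := rho_inv_ge2 R l0 (ncolors S v); rewrite -/r; lra.
Qed.
End LocalColorings.

Theorem theorem3 (R : realType) (k l n : nat) (k_gt0 : (0 < k)%N)
    (l_gt0 : (0 < l)%N) (C : eqType) (c : {set 'I_n} -> C)
    (c_local : local_coloring (complete_graph n) c k)
    (c_free : forall a : C,
       cycle_free (color_graph (complete_graph n) c a) (2 * l + 1)) :
  n%:R <= 2 * l%:R * (2 * l%:R - 1) ^+ (k - 1) *
          \prod_(2 <= d < k.+1) (1 + rho R l d + (rho R l d)^-1) :> R.
Proof.
rewrite -size_boundE //.
have sub_free S a : cycle_free (color_graph (complete_on S) c a) (2 * l + 1).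
  move=> s ss /andP[cyc us]; apply: (c_free a s ss); rewrite /ucycle us andbT.
  apply: sub_cycle cyc => x y /andP[/and3P[_ _ xy] cxy].
  by rewrite /color_graph /complete_graph xy.
have := total_weight_le1 R l_gt0 sub_free setT.
have : \sum_(u in [set: 'I_n]%SET) (size_bound R l k)^-1 <=
    \sum_(u in [set: 'I_n]%SET) weight R l c [set: 'I_n]%SET u.
  apply: ler_sum => u _; rewrite lef_pV2 ?posrE ?size_bound_gt0 // le_size_bound //.
  apply: leq_trans (c_local u); apply: uniq_leq_size; first exact: undup_uniq.
  move=> a /colorsP[w /andP[/and3P[_ _ uw] auw]].
  rewrite mem_undup; apply/mapP; exists w; first by rewrite mem_enum.
  exact/esym/eqP.
rewrite sumr_const cardsT card_ord => le1 le2.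
by have := le_trans le1 le2; rewrite -[_^-1 *+ n]mulr_natl ler_pdivrMr ?size_bound_gt0 // mul1r.
Qed.
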